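(* Let $d\ge 2$. For every $c>0$ there exists a constant $\delta=\delta(c)>0$ such that asymptotically almost surely (as $n\to\infty$) every minimal core subcomplex $K$ of $Y\in Y_d(n,\frac{c}{n})$ with $f_d(K)\le \delta n^d$ contains the boundary of a $(d+1)$-simplex.
   Context: $\Delta_{n-1}$ denotes the $(n-1)$-dimensional simplex on vertex set $[n]$. $Y_d(n,p)$ is the probability space of complexes $\Delta_{n-1}^{(d-1)}\subset Y\subset\Delta_{n-1}^{(d)}$ in which each $d$-simplex is included independently with probability $p$. Here a subcomplex $K$ of $Y$ is determined by a set of $d$-simplices of $Y$ (its $d$-simplices), and consists of these $d$-simplices together with all their faces; $f_d(K)$ is its number of $d$-simplices. Such a complex is a core if every $(d-1)$-face of it is contained in at least two of its $d$-simplices. A core is a minimal core if none of its proper subcomplexes (in the same sense, with nonempty set of $d$-simplices) is a core. *)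

(* Defs.v *)
From mathcomp Require Import all_boot all_order all_algebra.
From mathcomp Require Import reals.
Set Implicit Arguments. Unset Strict Implicit. Unset Printing Implicit Defensive.
Import Order.TTheory GRing.Theory Num.Theory.
Local Open Scope ring_scope.

(* Vertex set [n] is 'I_n; a simplex is a finite set of vertices.
   A subcomplex between the full (d-1)-skeleton and Delta^(d) is identified
   with its set of d-simplices (sets of size d+1). *)

Definition dsimplices (n d : nat) : {set {set 'I_n}} :=
  [set s : {set 'I_n} | #|s| == d.+1].

Definition dm1_face (n d : nat) (K : {set {set 'I_n}}) (f : {set 'I_n}) : bool :=
  (#|f| == d) && [exists s in K, f \subset s].

Definition is_core (n d : nat) (K : {set {set 'I_n}}) : bool :=
  (K \subset dsimplices n d) && (K != set0) &&
  [forall f : {set 'I_n}, dm1_face d K f ==>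
     (1 < #|[set s in K | f \subset s]|)%N].

Definition is_minimal_core (n d : nat) (K : {set {set 'I_n}}) : bool :=
  is_core d K && [forall K' : {set {set 'I_n}}, (K' \proper K) ==> ~~ is_core d K'].

Definition contains_boundary (n d : nat) (K : {set {set 'I_n}}) : bool :=
  [exists S : {set 'I_n}, (#|S| == d.+2) &&
     [forall s : {set 'I_n}, ((s \subset S) && (#|s| == d.+1)) ==> (s \in K)]].

Definition prob_Yd (R : realType) (n d : nat) (p : R)
    (E : {set {set 'I_n}} -> bool) : R :=
  \sum_(Y : {set {set 'I_n}} | (Y \subset dsimplices n d) && E Y)
     p ^+ #|Y| * (1 - p) ^+ (#|dsimplices n d| - #|Y|).

Definition good_event (R : realType) (n d : nat) (delta : R)
    (Y : {set {set 'I_n}}) : bool :=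
  [forall K : {set {set 'I_n}},
     ((K \subset Y) && is_minimal_core d K &&
      (#|K|%:R <= delta * (n%:R ^+ d))) ==> contains_boundary d K].

(* Main.v *)
Require Import Defs.
From mathcomp Require Import all_boot all_order all_algebra.
From mathcomp Require Import reals.
From mathcomp Require Import zify ring lra.
Set Implicit Arguments. Unset Strict Implicit. Unset Printing Implicit Defensive.

(** First moment: the probability that some bad core [K] lies in [Y] is at most
    the sum of [p ^ #|K|] over the bad cores, grouped by their size [m].

    - Bounded [m]: every vertex of a core lies in at least [d + 1] of its
      simplices, so a core has at most [m] vertices, with equality only if it
      contains the boundary of a simplex.  Otherwise it has at most [m - 1]
      vertices, and there are [O(n ^ (m - 1))] such cores.
    - Larger [m]: a minimal core is rebuilt from one of its simplices by
      repeatedly choosing an open face [f] (one lying in a single simplex so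
      far) and adding a simplex [v |: f]; minimality forces this to end exactly
      at [K].  A priori [v] has [n] choices per step, just too many.  For a
      family [H] of sets of fewer than [d] vertices, call a step saving if some
      [w] outside [H], properly contained in [f], is sent by adding [v] into
      [H] or to an already present face.  A step that is not saving increases
      the number of open faces with no proper subset in [H] (plus the number
      of closed pinned faces) by at least one, and this number is small for
      [K], so a constant fraction of the steps is saving.
    - For [m] at most a small power of [n], take [H] empty: a saving [v] is a
      vertex already present.  For larger [m], a set of [k] vertices is in [H]
      if it lies in at least a [1 / threshold k] fraction of the possible faces;
      the thresholds increase doubly exponentially as [k] decreases, so that
      only a small fraction of the [v] is saving and only a small fraction of
      the faces of [K] is pinned.  The family [H] is so sparse that it can be
      guessed at the cost of a factor [2 ^ m]. *)

(** * Elementary bounds on cardinalities *)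

Lemma card_bigcup_leq (I T : finType) (P : pred I) (F : I -> {set T}) :
  #|\bigcup_(i | P i) F i| <= \sum_(i | P i) #|F i|.
Proof.
elim/big_rec2: _ => [|i A m _ le]; first by rewrite cards0.
by apply: leq_trans (leq_card_setU _ _) _; rewrite leq_add2l.
Qed.

Lemma bin_leq_expn (a b : nat) : 'C(a, b) <= a ^ b.
Proof.
apply: leq_trans (leq_pmulr _ (fact_gt0 b)) _; rewrite bin_ffact.
by elim: b => // b IH; rewrite ffactnSr expnSr leq_mul // leq_subr.
Qed.

Lemma card_setD1_pred (T : finType) (A : {set T}) x : x \in A -> #|A :\ x| = #|A|.-1.
Proof. by move=> xA; rewrite (cardsD1 x A) xA. Qed.

(** * Cores with few vertices *)

Section Cores.
Variables (n d : nat).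
Implicit Types (K L H : {set {set 'I_n}}) (f s t : {set 'I_n}).

Definition faces L := [set f : {set 'I_n} | dm1_face d L f].
Definition star L f := [set s in L | f \subset s].

Lemma facesP L f :
  reflect (#|f| = d /\ exists2 s, s \in L & f \subset s) (f \in faces L).
Proof.
rewrite inE; apply: (iffP andP) => [[/eqP-> /existsP[s /andP[]]]|[-> [s sL fs]]].
  by split=> //; exists s.
by split=> //; apply/existsP; exists s; rewrite sL.
Qed.

Lemma core_simplex K s : is_core d K -> s \in K -> #|s| = d.+1.
Proof.
by case/andP=> /andP[/subsetP KD _] _ /KD; rewrite inE => /eqP.
Qed.

Lemma core_star K f : is_core d K -> f \in faces K -> 1 < #|star K f|.
Proof. by case/andP=> _ /forallP/(_ f)/implyP cK; rewrite inE => /cK. Qed.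

Lemma core_other K s f : is_core d K -> s \in K -> #|f| = d -> f \subset s ->
  exists2 t, t \in K & (t != s) && (f \subset t).
Proof.
move=> cK sK cf fs; have fF : f \in faces K by apply/facesP; split=> //; exists s.
have sS : s \in star K f by rewrite inE sK.
have := core_star cK fF; rewrite (cardsD1 s) sS ltnS card_gt0 => /set0Pn[t].
by rewrite !inE => /and3P[ts tK ft]; exists t => //; rewrite ts.
Qed.

Lemma core_neighbours K s x : is_core d K -> s \in K -> x \in s ->
  exists h : 'I_n -> {set 'I_n},
    [/\ {in s :\ x &, injective h},
        forall y, y \in s :\ x -> [/\ h y \in K, h y != s & s :\ y \subset h y] &
        [set h y | y in s :\ x] \subset star K [set x] :\ s].
Proof.
(* The default [s] of [h] is never taken for [y] in [s :\ x]. *)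
move=> cK sK xs; have cs := core_simplex cK sK.
pose h y := odflt s [pick t in K | (t != s) && (s :\ y \subset t)].
have hP y : y \in s :\ x -> [/\ h y \in K, h y != s & s :\ y \subset h y].
  rewrite inE => /andP[_ ys]; rewrite /h; case: pickP => [t /and3P[]|no] //=.
  have cy : #|s :\ y| = d by rewrite card_setD1_pred ?cs.
  have [t tK tP] := core_other cK sK cy (subD1set _ _).
  by have := no t; rewrite tK tP.
exists h; split=> //.
  move=> y y' ysx y'sx hE; apply/eqP/contraT => yy'.
  have [_ _ sy] := hP _ ysx; have [y'K y's sy'] := hP _ y'sx.
  case/negP: y's; rewrite eq_sym eqEcard (core_simplex cK y'K) cs leqnn andbT.
  apply/subsetP => z zs; have [zy|zy] := eqVneq z y.
    by apply: (subsetP sy'); rewrite !inE zs zy yy'.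
  by rewrite -hE; apply: (subsetP sy); rewrite !inE zs zy.
apply/subsetP => t /imsetP[y ysx ->]; have [yK ys sy] := hP _ ysx.
rewrite !inE ys yK sub1set /=; apply: (subsetP sy).
by move: ysx; rewrite !inE xs eq_sym => /andP[->].
Qed.

(** The simplex [s] and its d distinct neighbours across the faces through [x] all lie at [x]. *)
Lemma core_vertex_degree K s x : is_core d K -> s \in K -> x \in s ->
  d < #|star K [set x]|.
Proof.
move=> cK sK xs; have [h [hI hP /subset_leq_card]] := core_neighbours cK sK xs.
have sS : s \in star K [set x] by rewrite inE sK sub1set.
rewrite card_in_imset // (card_setD1_pred xs) (core_simplex cK sK) [X in _ < X](cardsD1 s).
by rewrite sS add1n ltnS.
Qed.

(** Equality in the degree bound: the star of [x] is exactly [s] and its neighbours [h y], each of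
    them [s :\ y] with an apex added. The point is that all these apices agree. *)
Lemma core_tight_vertex K s x : is_core d K -> s \in K -> x \in s -> 1 < d ->
  #|star K [set x]| <= d.+1 ->
  exists2 z, z \notin s & forall y, y \in s :\ x ->
    z |: (s :\ y) \in K /\
    (forall u, u \in K -> s :\ y \subset u -> u = s \/ u = z |: (s :\ y)).
Proof.
move=> cK sK xs d2 tight; have [h [hI hP hS]] := core_neighbours cK sK xs.
have cs := core_simplex cK sK.
have sS : s \in star K [set x] by rewrite inE sK sub1set.
have starE : [set h y | y in s :\ x] = star K [set x] :\ s.
  apply/eqP; rewrite eqEcard hS card_in_imset // (card_setD1_pred xs) cs.
  by move: tight; rewrite (cardsD1 s (star K [set x])) sS.
have stP u : u \in K -> x \in u -> u != s -> exists2 y, y \in s :\ x & u = h y.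
  move=> uK xu us; have : u \in star K [set x] :\ s by rewrite !inE us uK sub1set.
  by rewrite -starE => /imsetP[y ysx ->]; exists y.
have hE y : y \in s :\ x -> exists2 z, z \notin s & h y = z |: (s :\ y).
  move=> ysx; have [hK hs sh] := hP _ ysx.
  have ys : y \in s by move: ysx; rewrite inE => /andP[].
  have /set0Pn[z] : h y :\: s != set0.
    apply: contra hs; rewrite setD_eq0 => hys; rewrite eqEcard hys cs.
    by rewrite (core_simplex cK hK) leqnn.
  rewrite inE => /andP[zs zh]; exists z => //; apply/eqP.
  rewrite eq_sym eqEcard subUset sub1set zh sh (core_simplex cK hK) cardsU1.
  by rewrite in_setD1 (negPf zs) andbF card_setD1_pred // cs /= add1n ltnS.
(* The face [h y :\ y'] contains [x], so it has a second simplex [u] in the star. Since [z] is in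
   [u], [u] is not [s]; the only neighbour left for it is [h y'], whose apex is therefore [z]. *)
have same y y' z z' : y \in s :\ x -> y' \in s :\ x -> y != y' ->
    h y = z |: (s :\ y) -> z \notin s -> h y' = z' |: (s :\ y') -> z' = z.
  move=> ysx y'sx yy' hyE zs hy'E; have [hK hs sh] := hP _ ysx.
  move: (ysx) (y'sx); rewrite !inE => /andP[yx ys] /andP[y'x y's].
  have y'h : y' \in h y by rewrite hyE !inE y's [y' == y]eq_sym yy' orbT.
  have ch := core_simplex cK hK.
  have cf : #|h y :\ y'| = d by rewrite card_setD1_pred // ch.
  have [u uK /andP[uh fu]] := core_other cK hK cf (subD1set _ _).
  have zy' : z != y' by apply: contraNneq zs => ->.
  have zu : z \in u.
    by apply: (subsetP fu); rewrite !inE zy' hyE !inE eqxx.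
  have us : u != s by apply: contraNneq zs => <-.
  have xu : x \in u.
    by apply: (subsetP fu); rewrite !inE eq_sym y'x hyE !inE [x == y]eq_sym yx xs orbT.
  have [y2 y2sx uE] := stP u uK xu us.
  have [z2 z2s h2E] := hE _ y2sx.
  have y2s : y2 \in s by move: y2sx; rewrite inE => /andP[].
  have y2u : y2 \notin u.
    by rewrite uE h2E !inE eqxx orbF; apply: contraNneq z2s => <-.
  have y2E : y2 = y'.
    apply/eqP; apply: contraNT y2u => y2y'; apply: (subsetP fu).
    rewrite !inE y2y' hyE !inE y2s andbT; apply/orP; right.
    by apply: contraNneq uh => y2y; rewrite uE y2y.
  move: zu; rewrite uE y2E hy'E !inE (negPf zs) andbF orbF => /eqP.
  by [].
have [y0 y0sx] : exists y0, y0 \in s :\ x.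
  by apply/set0Pn; rewrite -card_gt0 card_setD1_pred // cs ltnW.
have [z zs h0E] := hE _ y0sx.
have hz y : y \in s :\ x -> h y = z |: (s :\ y).
  move=> ysx; have [<-//|y0y] := eqVneq y0 y.
  have [z' z's hyE] := hE _ ysx.
  by rewrite -(same _ _ _ _ y0sx ysx y0y h0E zs hyE).
exists z => // y ysx; have [hK hs sh] := hP _ ysx; rewrite -hz //; split=> // u uK syu.
have [->|us] := eqVneq u s; first by left.
right; have xu : x \in u.
  by apply: (subsetP syu); move: ysx; rewrite !inE xs eq_sym => /andP[->].
have [y2 y2sx uE] := stP u uK xu us.
have [z2 z2s h2E] := hE _ y2sx.
have [<-//|yy2] := eqVneq y2 y.
have : y2 \in u.
  by apply: (subsetP syu); move: y2sx; rewrite !inE yy2 => /andP[].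
rewrite uE h2E !inE eqxx orbF => /eqP y2z.
by move: y2sx; rewrite y2z !inE (negPf z2s) andbF.
Qed.

(** Two vertices [x], [x'] of a simplex [s] each give an apex, and a third vertex, which exists as d
    is at least 2, forces the apices to coincide. In [z |: s], the facets opposite the vertices of
    [s] other than [x] come from [x], the one opposite [x] comes from [x'], and the one opposite [z]
    is [s]. *)
Lemma tight_core_boundary K : is_core d K -> 1 < d ->
  (forall x, x \in cover K -> #|star K [set x]| <= d.+1) -> contains_boundary d K.
Proof.
move=> cK d2 tight; have [s sK] : exists s, s \in K.
  by case/andP: cK => /andP[_ /set0Pn].
have cs := core_simplex cK sK.
have inc x : x \in s -> x \in cover K by move=> xs; apply/bigcupP; exists s.
have [x [x' [xs x's xx']]] : exists x x', [/\ x \in s, x' \in s & x != x'].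
  by apply/card_gt1P; rewrite cs leqW.
have [z zs zP] := core_tight_vertex cK sK xs d2 (tight x (inc x xs)).
have [z' z's zP'] := core_tight_vertex cK sK x's d2 (tight x' (inc x' x's)).
have [y] : exists y, y \in s :\ x :\ x'.
  apply/set0Pn; rewrite -card_gt0 card_setD1_pred ?inE ?x's 1?eq_sym ?xx' //.
  by rewrite card_setD1_pred // cs /= -subn1 subn_gt0.
rewrite !inE => /and3P[yx' yx ys].
have ysx : y \in s :\ x by rewrite !inE yx.
have ysx' : y \in s :\ x' by rewrite !inE yx'.
have zz' : z = z'.
  have [zK _] := zP _ ysx; have [_ /(_ _ zK (subsetUr _ _))] := zP' _ ysx'.
  case=> E; first by move: zs; rewrite -E !inE eqxx.
  have : z \in z' |: (s :\ y) by rewrite -E !inE eqxx.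
  by rewrite !inE (negPf zs) andbF orbF => /eqP.
have all w : w \in s -> z |: (s :\ w) \in K.
  move=> ws; have [->|wx] := eqVneq w x.
    by rewrite zz'; have [] := zP' x; rewrite ?inE ?xx' ?xs.
  by have [] := zP w; rewrite ?inE ?wx.
apply/existsP; exists (z |: s); rewrite cardsU1 zs cs eqxx /=.
apply/forallP => t; apply/implyP => /andP[tS /eqP ct].
have cS : #|z |: s| = d.+2 by rewrite cardsU1 zs cs.
have : #|(z |: s) :\: t| == 1 by rewrite cardsD (setIidPr tS) cS ct subSnn.
case/cards1P => w wE.
have tE : t = (z |: s) :\ w.
  by rewrite -wE setDDr setDv set0U; apply/esym/setIidPr.
have : w \in (z |: s) :\: t by rewrite wE set11.
rewrite in_setD => /andP[_]; rewrite !inE => /orP[/eqP wz|ws].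
  by rewrite tE wz setU1K.
rewrite tE setDUl; have -> : [set z] :\: [set w] = [set z].
  apply/setDidPl; rewrite disjoints1 inE; apply: contraNneq zs => ->; exact: ws.
exact: all.
Qed.

(** Double counting of incidences: simplices have d + 1 vertices and vertices have degree at least d
    + 1, so at least as many vertices as simplices would make every degree exactly d + 1. *)
Lemma core_few_vertices K : is_core d K -> 1 < d -> ~~ contains_boundary d K ->
  #|cover K| < #|K|.
Proof.
move=> cK d2; apply: contraR; rewrite -leqNgt => KV.
apply: tight_core_boundary => // x xV; rewrite leqNgt; apply/negP => xbig.
have incid : \sum_(y in cover K) #|star K [set y]| = #|K| * d.+1.
  transitivity (\sum_(y in cover K) \sum_(s in K | y \in s) 1).
    apply: eq_bigr => y _; rewrite sum1_card; apply: eq_card => s.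
    by rewrite !inE sub1set.
  rewrite (exchange_big_dep (mem K)) /=; last by move=> y s _ /andP[].
  transitivity (\sum_(s in K) d.+1); last by rewrite sum_nat_const.
  apply: eq_bigr => s sK; rewrite sum1dep_card -(core_simplex cK sK).
  apply: eq_card => y; rewrite !inE sK /=; apply: andb_idl => ys.
  by apply/bigcupP; exists s.
have deg y : y \in cover K -> d < #|star K [set y]|.
  by case/bigcupP=> s sK ys; apply: (core_vertex_degree cK sK ys).
have : #|cover K| * d.+1 < \sum_(y in cover K) #|star K [set y]|.
  rewrite -sum_nat_const (bigD1 x) //= [X in _ < X](bigD1 x) //= -addSn.
  by apply: leq_add => //; apply: leq_sum => y /andP[/deg].
by rewrite incid ltn_mul2r /= ltnNge KV.
Qed.
End Cores.

(** * Counting minimal cores *)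

Section Counting.
Variables (n d : nat) (H : {set {set 'I_n}}).
Implicit Types (K L : {set {set 'I_n}}) (f g s t w : {set 'I_n}).

Notation faces := (faces d).

Definition saving L f : {set 'I_n} :=
  [set v | [exists w : {set 'I_n}, [&& w \proper f, w \notin H &
                       (v |: w \in H) || (v |: w \in faces L)]]].
Definition light f := [forall w : {set 'I_n}, (w \proper f) ==> (w \notin H)].
(** For nonempty [f]: the members of [H] inside [f] have no common vertex. These are the faces over
    which a step that is not saving may create no free face. *)
Definition pinned f := [forall x in f, exists w in H, w \subset f :\ x].
Definition free_faces L :=
  [set f in faces L | (#|star L f| <= 1) && light f].
Definition pinned_faces L := [set f in faces L | pinned f].
Definition closed_pinned L := [set f in pinned_faces L | 1 < #|star L f|].
(** The second term makes up for steps over pinned faces, so that every step that is not saving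
    raises the sum. *)
Definition potential L := #|free_faces L| + #|closed_pinned L|.

Lemma starS L L' f : L \subset L' -> star L f \subset star L' f.
Proof.
by move=> /subsetP LL'; apply/subsetP => s; rewrite !inE => /andP[/LL'-> ->].
Qed.

Lemma facesS L L' : L \subset L' -> faces L \subset faces L'.
Proof.
move=> /subsetP LL'; apply/subsetP => f /facesP[cf [s /LL' sL fs]].
by apply/facesP; split=> //; exists s.
Qed.

Lemma savingS L L' f : L \subset L' -> saving L f \subset saving L' f.
Proof.
move=> LL'; apply/subsetP => v; rewrite !inE => /existsP[w /and3P[wf wH vw]].
apply/existsP; exists w; rewrite wf wH /=; case/orP: vw => [->//|].
by move/(subsetP (facesS LL'))=> ->; rewrite orbT.
Qed.

Lemma closed_pinnedS L L' : L \subset L' -> closed_pinned L \subset closed_pinned L'.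
Proof.
move=> LL'; apply/subsetP => f; rewrite !in_set => /andP[/andP[fL ->] fs].
move: fL; rewrite -!in_set => /(subsetP (facesS LL')).
rewrite !in_set => -> /=; apply: leq_trans fs _; exact/subset_leq_card/starS.
Qed.

Lemma star_setU1 L s f : ~~ (f \subset s) -> star (s |: L) f = star L f.
Proof.
move=> fs; apply/setP => t; rewrite !inE; case: eqP => //= ->.
by rewrite (negPf fs) andbF.
Qed.

Lemma faces_setU1 L s f : ~~ (f \subset s) -> (f \in faces (s |: L)) = (f \in faces L).
Proof.
move=> fs; apply/facesP/facesP => -[cf [t tL ft]]; split=> //; exists t => //.
  by move: tL; rewrite !inE; case: eqP => // tE; rewrite -tE ft in fs.
by rewrite !inE tL orbT.
Qed.

Lemma free_faces_setU1 L s f : ~~ (f \subset s) ->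
  (f \in free_faces (s |: L)) = (f \in free_faces L).
Proof.
move=> fs; rewrite !(in_set (fun f => (f \in _) && _)) star_setU1 //.
by rewrite faces_setU1.
Qed.

(** * Effect of one rebuilding step on the potential *)

Section Step.
Variables (L : {set {set 'I_n}}) (f : {set 'I_n}) (v : 'I_n).
Hypothesis fL : f \in faces L.
Hypothesis fopen : #|star L f| <= 1.
Hypothesis vf : v \notin f.
Hypothesis sL : v |: f \notin L.
Let s := v |: f.
Let L' := s |: L.

(** Only the d + 1 faces of the added simplex can stop being free, and closed pinned faces stay
    closed and pinned. *)
Lemma potential_step_any : potential L <= potential L' + d.+1.
Proof.
have LL' : L \subset L' by apply: subsetUr.
have cf : #|f| = d by case/facesP: fL.
have cs : #|s| = d.+1 by rewrite cardsU1 vf cf.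
have : free_faces L \subset
    free_faces L' :|: [set g : {set 'I_n} | (g \subset s) && (#|g| == d)].
  apply/subsetP => g gL; rewrite in_setU; have [gs|gs] := boolP (g \subset s).
    apply/orP; right; rewrite in_set gs /=.
    by move: gL; rewrite in_set => /andP[/facesP[->]].
  by rewrite free_faces_setU1 // gL.
move/subset_leq_card => /leq_trans /(_ (leq_card_setU _ _)).
rewrite cards_draws cs binSn => le1.
have := subset_leq_card (closed_pinnedS LL'); rewrite /potential => le2.
by rewrite addnAC; apply: leq_add.
Qed.

Hypothesis nsave : v \notin saving L f.

Lemma nsaveP w : w \proper f -> w \notin H -> (v |: w \notin H) && (v |: w \notin faces L).
Proof.
move=> wf wH; rewrite -negb_or; apply: contra nsave => hv.
by rewrite in_set; apply/existsP; exists w; rewrite wf wH.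
Qed.

Lemma face_of_step g : #|g| = d -> g \subset s -> g != f ->
  exists2 x, x \in f & g = v |: (f :\ x).
Proof.
move=> cg gs gf; have cf : #|f| = d by case/facesP: fL.
have vg : v \in g.
  apply: contraNT gf => vg; rewrite eqEcard cf cg leqnn andbT; apply/subsetP => x xg.
  have := subsetP gs x xg; rewrite !inE => /orP[/eqP xv|//].
  by rewrite -xv xg in vg.
have /set0Pn[x] : f :\: g != set0.
  apply/negP; rewrite setD_eq0 => fg; case/negP: gf.
  by rewrite eq_sym eqEcard fg cf cg leqnn.
rewrite inE => /andP[xg xf]; exists x => //; apply/eqP; rewrite eqEcard; apply/andP; split.
  apply/subsetP => y yg; have := subsetP gs y yg; rewrite !inE => /orP[->//|->].
  by rewrite andbT (contraNneq _ xg) ?orbT // => <-.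
rewrite cardsU1 in_setD1 (negPf vf) andbF card_setD1_pred // cf cg /= add1n.
by rewrite prednK // -cf card_gt0; apply/set0Pn; exists x.
Qed.

(** Any other face of [s] has the form [v |: (f :\ x)]. If it were light, [f :\ x] would be outside
    [H], and a step that is not saving then keeps it out of the faces of [L]. *)
Lemma free_in_step g : g \in free_faces L -> g \subset s -> g = f.
Proof.
rewrite in_set => /andP[gL /andP[_ /forallP lg]] gs; apply/eqP/contraT => gf.
have cg : #|g| = d by case/facesP: gL.
have [x xf gE] := face_of_step cg gs gf.
have wg : f :\ x \proper g.
  by rewrite gE properUr // sub1set !inE negb_and (negPf vf) orbT.
have := nsaveP (properD1 xf) (implyP (lg _) wg).
by rewrite -gE gL andbF.
Qed.

(** As the step is not saving, this face is new, hence lies in [s] only. It is light: a subset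
    avoiding [v] lies in [f :\ x], and one containing [v] arises by adding [v] to a set outside
    [H]. *)
Lemma new_free_face x : x \in f -> (forall w, w \subset f :\ x -> w \notin H) ->
  v |: (f :\ x) \in free_faces L' :\: free_faces L.
Proof.
move=> xf lx; have cf : #|f| = d by case/facesP: fL.
have /andP[_ nF] := nsaveP (properD1 xf) (lx _ (subxx _)).
have cg : #|v |: (f :\ x)| = d.
  rewrite cardsU1 in_setD1 (negPf vf) andbF card_setD1_pred // cf /= add1n prednK //.
  by rewrite -cf card_gt0; apply/set0Pn; exists x.
have gs : v |: (f :\ x) \subset s by apply/setUS/subD1set.
rewrite in_setD !(in_set (fun g => (g \in faces _) && _)) (negPf nF) /=.
apply/and3P; split.
- by apply/facesP; split=> //; exists s => //; rewrite setU11.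
- rewrite -(cards1 s); apply/subset_leq_card/subsetP => t.
  rewrite !in_set => /andP[/orP[//|tL] gt]; case/negP: nF.
  by apply/facesP; split=> //; exists t.
apply/forallP => w; apply/implyP => wg; have [vw|vw] := boolP (v \in w).
  have wE : w = v |: (w :\ v) by rewrite setD1K.
  rewrite wE; suff /nsaveP : w :\ v \proper f.
    case/(_ _)/andP => //; apply: lx.
    apply/subsetP => y; rewrite !inE => /andP[yv yw].
    by have := subsetP (proper_sub wg) y yw; rewrite !inE (negPf yv).
  apply: sub_proper_trans (properD1 xf).
  apply/subsetP => y; rewrite !inE => /andP[yv yw].
  by have := subsetP (proper_sub wg) y yw; rewrite !inE (negPf yv).
apply: lx; apply/subsetP => y yw; have := subsetP (proper_sub wg) y yw.
by rewrite !inE => /orP[/eqP yv|//]; rewrite -yv yw in vw.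
Qed.

(** If [f] is light, it may cease to be free, but two of its vertices give two new free faces. If
    [f] is not light, no free face is lost: either [f] is pinned and becomes closed, or some [x]
    yields a new free face. *)
Lemma potential_step_nsave : 1 < d -> potential L < potential L'.
Proof.
move=> d2; have LL' : L \subset L' by apply: subsetUr.
have cf : #|f| = d by case/facesP: fL.
have cpS := closed_pinnedS LL'.
have keep : free_faces L :\ f \subset free_faces L'.
  apply/subsetP => g /setD1P[gf gL]; have [gs|gs] := boolP (g \subset s).
    by rewrite (free_in_step gL gs) eqxx in gf.
  by rewrite free_faces_setU1.
have [lf|/negP lf] := boolP (light f).
  have [x [y [xf yf xy]]] : exists x y, [/\ x \in f, y \in f & x != y].
    by apply/card_gt1P; rewrite cf.
  have lz z w : z \in f -> w \subset f :\ z -> w \notin H.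
    move=> zf wz; move/forallP/(_ w)/implyP: lf; apply.
    exact: sub_proper_trans wz (properD1 zf).
  have := new_free_face xf (fun w => lz x w xf); rewrite inE => /andP[xn xn'].
  have := new_free_face yf (fun w => lz y w yf); rewrite inE => /andP[yn yn'].
  set gx := v |: _ in xn xn'; set gy := v |: _ in yn yn'.
  have gxy : gx != gy.
    apply: contra_neq xy => gE; apply/eqP/contraT => xy.
    have : x \in gy by rewrite !inE xy xf orbT.
    rewrite -gE !inE eqxx orbF => /eqP xv.
    by rewrite xv (negPf vf) in xf.
  have : gx |: (gy |: (free_faces L :\ f)) \subset free_faces L'.
    by rewrite !subUset !sub1set xn' yn' keep.
  move/subset_leq_card; rewrite !cardsU1 !in_setU1 !in_setD1 (negPf xn) (negPf yn).
  rewrite (negPf gxy) !andbF /= => le1.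
  have le2 := subset_leq_card cpS.
  rewrite /potential (cardsD1 f) -addSn; apply: leq_add => //.
  apply: leq_trans le1; rewrite !add1n -addSn.
  by case: (f \in _); rewrite ?leqnn ?leqnSn.
have fnf : f \notin free_faces L by rewrite in_set; apply/negP => /andP[_ /andP[_ /lf]].
have keep' : free_faces L \subset free_faces L'.
  apply: subset_trans keep; apply/subsetP => g gL; rewrite in_setD1 gL andbT.
  by apply: contraNneq fnf => <-.
have [pf|] := boolP (pinned f).
  have : f |: closed_pinned L \subset closed_pinned L'.
    rewrite subUset cpS andbT sub1set !(in_set (fun g => (g \in _) && _)) pf.
    rewrite (subsetP (facesS LL')) //=.
    have [cf' [t tL ft]] := facesP _ _ _ fL.
    apply/card_gt1P; exists t, s; split.
    - by rewrite in_set in_setU1 tL orbT ft.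
    - by rewrite in_set in_setU1 eqxx subsetUr.
    by apply: contraNneq sL => ts; rewrite -/s -ts.
  move/subset_leq_card; rewrite cardsU1 in_set [_ < _]ltnNge fopen andbF /= => le1.
  by rewrite /potential -addnS; apply: leq_add => //; apply: subset_leq_card.
rewrite negb_forall => /existsP[x]; rewrite negb_imply => /andP[xf].
rewrite negb_exists => /forallP nx.
have nxw w : w \subset f :\ x -> w \notin H.
  by move=> wx; have := nx w; rewrite wx andbT.
have := new_free_face xf nxw; rewrite in_setD => /andP[xn xn'].
have : (v |: (f :\ x)) |: free_faces L \subset free_faces L'.
  by rewrite subUset sub1set xn'.
move/subset_leq_card; rewrite cardsU1 xn /= => le1.
by rewrite /potential -addSn; apply: leq_add => //; apply: subset_leq_card.
Qed.
End Step.

(** * Rebuilding a sparse minimal core from one simplex *)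

(** The exponent [d.+2] pays for the loss of potential d + 1 in a saving step and for the step
    itself. The factor 4 keeps the final potential below a quarter of the size. *)
Definition sparse_core e K :=
  [&& is_minimal_core d K, 4 * #|pinned_faces K| <= #|K| &
      [forall f in faces K, #|saving K f| * e ^ d.+2 <= n]].

Definition extensions e m L := [set K | [&& sparse_core e K, L \subset K & #|K| == m]].

Lemma extensionsP e m L K : K \in extensions e m L ->
  [/\ is_core d K, forall K', K' \proper K -> ~~ is_core d K',
      4 * #|pinned_faces K| <= m,
      forall f, f \in faces K -> #|saving K f| * e ^ d.+2 <= n &
      L \subset K /\ #|K| = m].
Proof.
rewrite in_set => /and3P[/and3P[/andP[cK /forallP minK] pK /forallP sK] LK /eqP Km].
split=> //; first by move=> K' K'K; apply: (implyP (minK K')).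
  by rewrite -Km.
by move=> f fK; apply: (implyP (sK f)).
Qed.

Lemma open_face K L : is_core d K -> L \proper K -> L != set0 -> ~~ is_core d L ->
  exists2 f, f \in faces L & #|star L f| <= 1.
Proof.
move=> cK LK L0; have KD : K \subset dsimplices n d by case/andP: cK => /andP[].
rewrite /is_core L0 (subset_trans (proper_sub LK) KD) /= negb_forall.
case/existsP=> f; rewrite negb_imply -leqNgt => /andP[fL fo].
by exists f => //; rewrite inE.
Qed.

(** In a core [f] lies in two simplices, in [L] in at most one, so a simplex of the core over [f] is
    still missing from [L]. *)
Lemma extensions_step e m L f : f \in faces L -> #|star L f| <= 1 ->
  extensions e m L \subset
    \bigcup_(v | (v \notin f) && (v |: f \notin L)) extensions e m ((v |: f) |: L).
Proof.
move=> fL fo; apply/subsetP => K KE; have [cK _ _ _ [LK Km]] := extensionsP KE.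
have fK : f \in faces K by apply: (subsetP (facesS LK)).
have /set0Pn[s] : star K f :\: star L f != set0.
  rewrite setD_eq0; apply: contraTN fo => /subset_leq_card; rewrite -ltnNge.
  exact: leq_trans (core_star cK fK).
rewrite in_setD !in_set => /andP[nsL /andP[sK fs]].
have sL : s \notin L by apply: contra nsL => ->.
have [cf _] := facesP _ _ _ fK; have cs := core_simplex cK sK.
have : #|s :\: f| == 1 by rewrite cardsD (setIidPr fs) cs cf subSnn.
case/cards1P=> v vE; have vsf : v \in s :\: f by rewrite vE set11.
have sE : s = v |: f by rewrite -vE setUC -{1}(setIidPr fs) setID.
move: vsf; rewrite in_setD => /andP[vf _].
apply/bigcupP; exists v; rewrite ?vf -?sE //.
move: KE; rewrite !(in_set (fun K => [&& _ & _])) => /and3P[-> LK' ->].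
by rewrite subUset sub1set sK LK'.
Qed.

(** Induction on the number [j] of missing simplices. Among the n choices of [v], those that are not
    saving gain a power of [e] in potential; the saving ones lose at most [e ^ d.+2] but are rarer
    by that factor. Each kind contributes at most n times the bound for [j]. *)
Lemma card_extensions e m j L : 1 < d -> 0 < e -> L != set0 -> m = #|L| + j ->
  #|extensions e m L| * e ^ (j + potential L) <= (2 * n) ^ j * e ^ (m %/ 4).
Proof.
move=> d2 e0; elim: j L => [|j IH] L L0 mE.
  have [->|[K KE]] := set_0Vmem (extensions e m L); first by rewrite cards0.
  have eqL K' : K' \in extensions e m L -> K' = L.
    case/extensionsP => _ _ _ _ [LK Km]; apply/eqP; rewrite eq_sym eqEcard LK.
    by rewrite Km mE addn0 leqnn.
  have ext1 : #|extensions e m L| <= 1.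
    rewrite -(cards1 L); apply/subset_leq_card/subsetP => K' /eqL ->.
    exact: set11.
  (* Now [L] is itself the core: it has no open face, and its potential only counts pinned faces. *)
  have [cK _ pK _ _] := extensionsP KE; rewrite (eqL _ KE) in cK pK.
  rewrite expn0; apply: leq_mul => //; rewrite add0n leq_pexp2l //.
  rewrite /potential; have -> : free_faces L = set0.
    apply/setP => f; rewrite in_set0; apply/negbTE/negP.
    rewrite in_set => /andP[/(core_star cK) fL /andP[fo _]].
    by rewrite ltnNge fo in fL.
  rewrite cards0 add0n leq_divRL // mulnC; apply: leq_trans pK.
  rewrite leq_mul2l /=; apply/subset_leq_card/subsetP => f.
  by rewrite in_set => /andP[].
have [->|[K KE]] := set_0Vmem (extensions e m L); first by rewrite cards0.
have [cK minK _ sK [LK Km]] := extensionsP KE.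
have LpK : L \proper K by rewrite properEcard LK Km mE addnS ltnS leq_addr.
have [f fL fo] := open_face cK LpK L0 (minK _ LpK).
have fK := subsetP (facesS LK) _ fL.
set B := (2 * n) ^ j * e ^ (m %/ 4).
(* Saving is measured in one fixed extension [K], where it is known to be rare; [saving L f] is
   contained in [saving K f]. *)
pose G v := B + (v \in saving K f) * (e ^ d.+2 * B).
have step v : (v \notin f) && (v |: f \notin L) ->
    #|extensions e m ((v |: f) |: L)| * e ^ (j.+1 + potential L) <= G v.
  case/andP=> vf vL; set L' := _ |: L.
  have L'0 : L' != set0 by apply/set0Pn; exists (v |: f); apply: setU11.
  have mE' : m = #|L'| + j by rewrite cardsU1 vL mE /= add1n addSnnS.
  have IHv := IH L' L'0 mE'; rewrite /G.
  have [vs|vs] := boolP (v \in saving K f).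
    rewrite mul1n; apply: leq_trans (leq_addl _ _).
    apply: (@leq_trans (#|extensions e m L'| * (e ^ d.+2 * e ^ (j + potential L')))).
      rewrite leq_mul2l -expnD leq_pexp2l ?orbT //.
      have -> : d.+2 + (j + potential L') = j.+1 + (potential L' + d.+1).
        by rewrite !addSn !addnS addnCA [d + _]addnC.
      by rewrite leq_add2l; apply: potential_step_any.
    by rewrite mulnCA leq_mul2l IHv orbT.
  rewrite mul0n addn0; apply: leq_trans IHv; rewrite leq_mul2l leq_pexp2l ?orbT //.
  have vsL : v \notin saving L f by apply: contra vs; apply: (subsetP (savingS f LK)).
  by rewrite addSnnS leq_add2l; apply: potential_step_nsave.
have /subset_leq_card := extensions_step e m fL fo.
move/leq_trans/(_ (card_bigcup_leq _ _)).
rewrite -(@leq_pmul2r (e ^ (j.+1 + potential L))) ?expn_gt0 ?e0 //.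
move/leq_trans; apply; rewrite big_distrl /=.
apply: (@leq_trans (\sum_(v : 'I_n) G v)).
  rewrite [X in _ <= X](bigID (fun v => (v \notin f) && (v |: f \notin L))) /=.
  by apply: leq_trans (leq_addr _ _); apply: leq_sum.
rewrite big_split /= sum_nat_const card_ord -big_distrl /=.
have -> : \sum_(v : 'I_n) (v \in saving K f) = #|saving K f|.
  by rewrite -sum1_card [RHS]big_mkcond; apply: eq_bigr => v _; case: ifP.
rewrite [(2 * n) ^ j.+1]expnS -[2 * n * _ * _]mulnA -/B; apply: (@leq_trans (n * B + n * B)).
  by rewrite leq_add2l mulnA leq_mul2r sK ?orbT.
by rewrite addnn -mul2n mulnA.
Qed.

Lemma card_sparse_cores e m : 1 < d -> 0 < e ->
  #|[set K | sparse_core e K && (#|K| == m.+1)]| * e ^ m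
     <= n ^ d.+1 * ((2 * n) ^ m * e ^ (m.+1 %/ 4)).
Proof.
move=> d2 e0.
have sub : [set K | sparse_core e K && (#|K| == m.+1)] \subset
    \bigcup_(s in dsimplices n d) extensions e m.+1 [set s].
  apply/subsetP => K; rewrite in_set => /andP[spK Km].
  have cK : is_core d K by case/and3P: spK => /andP[].
  have /set0Pn[s sK] : K != set0 by case/andP: cK => /andP[].
  apply/bigcupP; exists s; first by rewrite in_set (core_simplex cK sK).
  by rewrite in_set spK Km sub1set sK.
apply: leq_trans (leq_mul (subset_leq_card sub) (leqnn _)) _.
apply: leq_trans (leq_mul (card_bigcup_leq _ _) (leqnn _)) _.
rewrite big_distrl /=.
apply: (@leq_trans (\sum_(s in dsimplices n d) (2 * n) ^ m * e ^ (m.+1 %/ 4))).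
  apply: leq_sum => s _.
  have s0 : [set s] != set0 by apply/set0Pn; exists s; apply: set11.
  have mE : m.+1 = #|[set s]| + m by rewrite cards1.
  apply: leq_trans (card_extensions d2 e0 s0 mE).
  by rewrite leq_mul2l leq_pexp2l ?orbT // leq_addr.
rewrite sum_nat_const leq_mul2r; apply/orP; right.
rewrite /dsimplices card_draws card_ord.
exact: bin_leq_expn.
Qed.
End Counting.

(** * Heavy sets *)

Section Heavy.
Variables (n d a : nat) (K : {set {set 'I_n}}).
Hypothesis n0 : 0 < n.
Hypothesis a0 : 0 < a.
Implicit Types (f g s t w : {set 'I_n}).

Let F : {set {set 'I_n}} := faces d K.

(** Solves the recursion in which [threshold k] is [a] times the square of [threshold k.+1],
    starting from [threshold d = 1]. *)
Definition threshold k := a ^ (2 ^ (d - k)).-1.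
Definition up w := #|[set f in F | w \subset f]|.
Definition heavy : {set {set 'I_n}} :=
  [set w : {set 'I_n} | (#|w| < d) && (n ^ (d - #|w|) <= threshold #|w| * up w)].
Definition heavy_links w := [set v | (v |: w \in heavy) || (v |: w \in F)].

Lemma threshold_gt0 k : 0 < threshold k.
Proof. by rewrite expn_gt0 a0. Qed.

Lemma thresholdS k : k < d -> threshold k = a * threshold k.+1 * threshold k.+1.
Proof.
move=> kd; rewrite /threshold -(subnSK kd) -mulnA -expnD -expnS expnS mul2n -addnn.
have : 0 < 2 ^ (d - k.+1) by rewrite expn_gt0.
by case: (2 ^ _) => // m _; rewrite addSn addnS.
Qed.

Lemma leq_threshold j k : j <= k -> threshold k <= threshold j.
Proof.
move=> jk; rewrite leq_pexp2l // -!subn1 leq_sub2r // leq_pexp2l //.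
exact: leq_sub2l.
Qed.

Lemma sum_up (X : {set {set 'I_n}}) : \sum_(w in X) up w <= 2 ^ d * #|F|.
Proof.
have -> : \sum_(w in X) up w = \sum_(w in X) \sum_(f in F | w \subset f) 1.
  apply: eq_bigr => w _; by rewrite sum1dep_card.
rewrite (exchange_big_dep (mem F)) /=; last by move=> w f _ /andP[].
rewrite mulnC -sum_nat_const; apply: leq_sum => f fF.
have [cf _] := facesP _ _ _ fF.
rewrite -cf -card_powerset sum1dep_card; apply/subset_leq_card/subsetP => w.
by rewrite !inE => /and3P[].
Qed.

Definition heavy_at k := [set w in heavy | #|w| == k].

(** Counts pairs of a heavy set and a face above it; a face has [2 ^ d] subsets. *)
Lemma card_heavy_at k : #|heavy_at k| * n ^ (d - k) <= threshold k * (2 ^ d * #|F|).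
Proof.
apply: leq_trans (leq_mul (leqnn _) (sum_up (heavy_at k))).
rewrite -sum_nat_const big_distrr /=; apply: leq_sum => w.
by rewrite in_set => /andP[]; rewrite in_set => /andP[_ ?] /eqP <-.
Qed.

Lemma card_heavy : #|heavy| * n <= d * (threshold 0 * (2 ^ d * #|F|)).
Proof.
have sub : heavy \subset \bigcup_(k < d) heavy_at k.
  apply/subsetP => w wH; have : #|w| < d by move: wH; rewrite in_set => /andP[].
  by move=> wd; apply/bigcupP; exists (Ordinal wd) => //; rewrite in_set wH /=.
apply: leq_trans (leq_mul (subset_leq_card sub) (leqnn _)) _.
apply: leq_trans (leq_mul (card_bigcup_leq _ _) (leqnn _)) _.
rewrite big_distrl /= -[d in d * _]card_ord -sum_nat_const; apply: leq_sum => k _.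
apply: leq_trans (_ : threshold k * (2 ^ d * #|F|) <= _); last first.
  by rewrite leq_mul2r leq_threshold ?orbT.
apply: leq_trans (card_heavy_at k); rewrite leq_mul2l.
have n1 : n ^ 1 <= n ^ (d - k) by rewrite leq_pexp2l // subn_gt0.
by rewrite expn1 in n1; rewrite n1 orbT.
Qed.

Lemma sum_up_setU1 w (D : {set 'I_n}) : \sum_(v in D) up (v |: w) <= d * up w.
Proof.
have -> : \sum_(v in D) up (v |: w) =
    \sum_(v in D) \sum_(f in [set f in F | w \subset f] | v \in f) 1.
  apply: eq_bigr => v _; rewrite sum1dep_card; apply: eq_card => f.
  by rewrite !(in_set (fun f => _ && _)) subUset sub1set andbCA andbC.
rewrite (exchange_big_dep (mem [set f in F | w \subset f])) /=; last by move=> v f _ /andP[].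
rewrite mulnC -sum_nat_const; apply: leq_sum => f fw.
have [cf _] : #|f| = d /\ exists2 s, s \in K & f \subset s.
  by apply/facesP; move: fw; rewrite in_set => /andP[].
rewrite -[X in _ <= X]cf sum1dep_card; apply/subset_leq_card/subsetP => v.
by rewrite in_set => /and3P[].
Qed.

(** Every link [v] puts many faces above [v |: w], and each face above [w] is counted at most d
    times, while [w] itself has few faces above it. The ratio of consecutive thresholds gives the
    factor [a * threshold #|w|.+1]. *)
Lemma card_heavy_links w : #|w| < d -> w \notin heavy ->
  #|heavy_links w| * (a * threshold #|w|.+1) <= d * n.
Proof.
set k := #|w| => kd wH.
have nwF : w \notin F by apply/negP => /facesP[cw _]; rewrite -/k in cw; rewrite cw ltnn in kd.
have upw : threshold k * up w <= n ^ (d - k).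
  by move: wH; rewrite in_set -/k kd /= -ltnNge => /ltnW.
have each v : v \in heavy_links w -> n ^ (d - k.+1) <= threshold k.+1 * up (v |: w).
  move=> vD; have vw : v \notin w.
    apply/negP => vw; move: vD; rewrite in_set setUC.
    by rewrite (setUidPl _) ?sub1set // (negPf wH) (negPf nwF).
  have cvw : #|v |: w| = k.+1 by rewrite cardsU1 vw.
  move: vD; rewrite in_set => /orP[|vF].
    by rewrite in_set cvw => /andP[].
  (* Here [v |: w] is a face, so the power of n is [n ^ 0] and a single face above it suffices. *)
  have dE : k.+1 = d by rewrite -cvw; have [] := facesP _ _ _ vF.
  rewrite dE subnn expn0 muln_gt0 threshold_gt0 card_gt0; apply/set0Pn.
  by exists (v |: w); rewrite in_set vF subxx.
have le1 : #|heavy_links w| * n ^ (d - k.+1) <= threshold k.+1 * (d * up w).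
  apply: leq_trans (leq_mul (leqnn _) (sum_up_setU1 w (heavy_links w))).
  by rewrite -sum_nat_const big_distrr /=; apply: leq_sum.
have c0 : 0 < threshold k.+1 * n ^ (d - k.+1) by rewrite muln_gt0 threshold_gt0 expn_gt0 n0.
rewrite -(leq_pmul2r c0).
have -> : #|heavy_links w| * (a * threshold k.+1) * (threshold k.+1 * n ^ (d - k.+1))
    = #|heavy_links w| * n ^ (d - k.+1) * threshold k.
  by rewrite (thresholdS kd); ring.
apply: leq_trans (leq_mul le1 (leqnn _)) _.
have -> : threshold k.+1 * (d * up w) * threshold k =
          d * threshold k.+1 * (threshold k * up w).
  by ring.
have -> : d * n * (threshold k.+1 * n ^ (d - k.+1)) = d * threshold k.+1 * n ^ (d - k).
  by rewrite mulnACA -expnS subnSK.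
by rewrite leq_mul2l upw orbT.
Qed.

(** A saving [v] is a heavy link of one of the at most [2 ^ d] non-heavy proper subsets of [f]. *)
Lemma card_saving_heavy f : f \in F -> #|saving d heavy K f| * a <= 2 ^ d * (d * n).
Proof.
move=> fF; have [cf _] := facesP _ _ _ fF.
have sub : saving d heavy K f \subset
    \bigcup_(w in powerset f | (#|w| < d) && (w \notin heavy)) heavy_links w.
  apply/subsetP => v; rewrite in_set => /existsP[w /and3P[wf wH vw]].
  apply/bigcupP; exists w; last by rewrite in_set.
  by rewrite in_set (proper_sub wf) wH -cf proper_card.
apply: leq_trans (leq_mul (subset_leq_card sub) (leqnn _)) _.
apply: leq_trans (leq_mul (card_bigcup_leq _ _) (leqnn _)) _.
rewrite big_distrl /= -[X in 2 ^ X]cf -card_powerset -sum_nat_const.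
rewrite [X in _ <= X](bigID (fun w => (#|w| < d) && (w \notin heavy))) /=.
apply: leq_trans (leq_addr _ _); apply: leq_sum => w /andP[_ /andP[wd wH]].
apply: leq_trans (card_heavy_links wd wH); rewrite leq_mul2l.
by rewrite leq_pmulr ?orbT // threshold_gt0.
Qed.

(* Take [x |: w] to be a smallest heavy subset of [f] and [g] a heavy set that misses [x]. *)
Lemma pinned_heavy f : 0 < d -> f \in F -> set0 \notin heavy -> pinned heavy f ->
  exists x w g, [/\ x \in f, w \subset f :\ x, w \notin heavy, x \in heavy_links w &
    [/\ g \in heavy, g \subset f :\ x & #|w| < #|g|]].
Proof.
move=> d0 fF H0 /forallP pf; have [cf _] := facesP _ _ _ fF.
have avoid x : x \in f -> exists2 w, w \in heavy & w \subset f :\ x.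
  by move=> xf; have /existsP[w /andP[]] := implyP (pf x) xf; exists w.
have [w0 w0P] : exists w0, (w0 \in heavy) && (w0 \subset f).
  have /set0Pn[x xf] : f != set0 by rewrite -card_gt0 cf.
  have [w wH wf] := avoid x xf; exists w; rewrite wH.
  exact: subset_trans wf (subD1set _ _).
pose P w := (w \in heavy) && (w \subset f).
have [h /andP[hH hf] hmin] := @arg_minnP _ w0 P (fun w => #|w|) w0P.
have /set0Pn[x xh] : h != set0 by apply: contraNneq H0 => <-.
have xf : x \in f by apply: (subsetP hf).
have [g gH gf] := avoid x xf.
have gf' : g \subset f := subset_trans gf (subD1set _ _).
have hg : #|h| <= #|g| by apply: hmin; rewrite /P gH.
have wh : #|h :\ x| < #|h| by rewrite [X in _ < X](cardsD1 x) xh.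
exists x, (h :\ x), g; split=> //.
- exact: setSD.
- apply/negP => wH; have := hmin (h :\ x); rewrite /P wH /= leqNgt wh.
  by move=> /(_ (subset_trans (subD1set _ _) hf)).
- by rewrite in_set setD1K // hH.
by split=> //; apply: leq_trans hg.
Qed.

(** * Bound on the number of pinned faces *)

Lemma card_supersets w m :
  #|[set g : {set 'I_n} | (w \subset g) && (#|g| == #|w| + m)]| <= n ^ m.
Proof.
rewrite -[X in _ <= X ^ _]card_ord; apply: leq_trans (bin_leq_expn _ _).
rewrite -card_draws; pose h g := g :\: w.
rewrite -(@card_in_imset _ _ h).
  apply/subset_leq_card/subsetP => _ /imsetP[g + ->]; rewrite !in_set => /andP[wg /eqP cg].
  by rewrite cardsD (setIidPr wg) cg addKn.
move=> g g'; rewrite !in_set => /andP[wg _] /andP[wg' _] hE.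
by rewrite -(setID g w) -(setID g' w) (setIidPr wg) (setIidPr wg') -/(h g) hE.
Qed.

Definition ridges k := [set g : {set 'I_n} | (#|g| == d.-1) &&
   [exists w : {set 'I_n}, (w \in heavy_at k) && (w \subset g)]].

Lemma card_ridges k : k < d -> #|ridges k| <= #|heavy_at k| * n ^ (d.-1 - k).
Proof.
move=> kd; have kd1 : k <= d.-1 by rewrite -ltnS prednK // (leq_ltn_trans _ kd).
have sub : ridges k \subset \bigcup_(w in heavy_at k)
    [set g : {set 'I_n} | (w \subset g) && (#|g| == #|w| + (d.-1 - k))].
  apply/subsetP => g; rewrite in_set => /andP[/eqP cg /existsP[w /andP[wk wg]]].
  apply/bigcupP; exists w => //; rewrite in_set wg cg.
  move: wk; rewrite in_set => /andP[_ /eqP ->]; by rewrite subnKC ?eqxx.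
apply: leq_trans (subset_leq_card sub) _; apply: leq_trans (card_bigcup_leq _ _) _.
by rewrite -sum_nat_const; apply: leq_sum => w _; apply: card_supersets.
Qed.

(** A family covering the pinned faces that is easy to count: choose a ridge above a heavy set of
    size [k], then a link of a smaller non-heavy subset of the ridge. *)
Definition pinned_at k := \bigcup_(g in ridges k)
  \bigcup_(w in powerset g | (#|w| < k) && (w \notin heavy)) [set x |: g | x in heavy_links w].

Lemma pinned_sub : 0 < d -> set0 \notin heavy ->
  pinned_faces d heavy K \subset \bigcup_(k < d) pinned_at k.
Proof.
move=> d0 H0; apply/subsetP => f; rewrite in_set => /andP[fF pf].
have [cf _] := facesP _ _ _ fF.
have [x [w [g [xf wf wH xw [gH gf wg]]]]] := pinned_heavy d0 fF H0 pf.
have gd : #|g| < d by move: gH; rewrite in_set => /andP[].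
apply/bigcupP; exists (Ordinal gd) => //; apply/bigcupP; exists (f :\ x).
  rewrite in_set card_setD1_pred // cf eqxx /=; apply/existsP; exists g.
  by rewrite in_set gH eqxx gf.
apply/bigcupP; exists w; first by rewrite powersetE wf wg wH.
by apply/imsetP; exists x => //; rewrite setD1K.
Qed.

(** The number of ridges carries a factor [threshold k]. It cancels against the scarcity of links:
    [w] has fewer than [k] vertices, so [threshold #|w|.+1] is at least [threshold k]. *)
Lemma card_pinned_at k : k < d -> #|pinned_at k| * a <= 2 ^ d * d * (2 ^ d * #|F|).
Proof.
move=> kd; have d0 : 0 < d by apply: leq_ltn_trans kd.
rewrite -(leq_pmul2r (threshold_gt0 k)) -mulnA.
apply: (@leq_trans (#|ridges k| * (2 ^ d * (d * n)))).
  apply: leq_trans (leq_mul (card_bigcup_leq _ _) (leqnn _)) _.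
  rewrite big_distrl -sum_nat_const /=; apply: leq_sum => g.
  rewrite in_set => /andP[/eqP cg _].
  apply: leq_trans (leq_mul (card_bigcup_leq _ _) (leqnn _)) _.
  apply: (@leq_trans (#|powerset g| * (d * n))); last first.
    by rewrite card_powerset cg leq_mul2r leq_pexp2l ?orbT // leq_pred.
  rewrite big_distrl /= -sum_nat_const.
  rewrite [X in _ <= X](bigID (fun w => (#|w| < k) && (w \notin heavy))) /=.
  apply: leq_trans (leq_addr _ _); apply: leq_sum => w /andP[_ /andP[wk wH]].
  apply: leq_trans (card_heavy_links (ltn_trans wk kd) wH).
  by rewrite leq_mul ?leq_imset_card // leq_mul2l leq_threshold ?orbT.
apply: leq_trans (leq_mul (card_ridges kd) (leqnn _)) _.
have -> : #|heavy_at k| * n ^ (d.-1 - k) * (2 ^ d * (d * n)) =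
          2 ^ d * d * (#|heavy_at k| * n ^ (d - k)).
  have -> : d - k = (d.-1 - k).+1 by case: (d) d0 kd => // m _ km; rewrite subSn.
  by rewrite expnSr; ring.
apply: leq_trans (leq_mul (leqnn _) (card_heavy_at k)) _.
by rewrite -[X in _ <= X]mulnA leq_mul2l [X in _ <= X]mulnC leqnn orbT.
Qed.

Lemma card_pinned : 0 < d -> set0 \notin heavy ->
  #|pinned_faces d heavy K| * a <= d * (2 ^ d * d * (2 ^ d * #|F|)).
Proof.
move=> d0 H0; apply: leq_trans (leq_mul (subset_leq_card (pinned_sub d0 H0)) (leqnn _)) _.
apply: leq_trans (leq_mul (card_bigcup_leq _ _) (leqnn _)) _.
rewrite big_distrl /= -[X in _ <= X * _]card_ord -sum_nat_const; apply: leq_sum => k _.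
exact: card_pinned_at.
Qed.

(** All faces lie above the empty set; the upper bound on the size of [K] enters through this. *)
Lemma set0_light : threshold 0 * #|F| < n ^ d -> set0 \notin heavy.
Proof.
move=> small; rewrite in_set; apply/negP => /andP[_]; rewrite cards0 subn0 leqNgt.
suff -> : up set0 = #|F| by rewrite small.
by apply: eq_card => f; rewrite in_set sub0set andbT.
Qed.

Lemma card_faces : K \subset dsimplices n d -> #|F| <= d.+1 * #|K|.
Proof.
move=> /subsetP KD.
have sub : F \subset \bigcup_(s in K) [set f : {set 'I_n} | (f \subset s) && (#|f| == d)].
  apply/subsetP => f /facesP[cf [s sK fs]]; apply/bigcupP; exists s => //.
  by rewrite in_set fs cf eqxx.
apply: leq_trans (subset_leq_card sub) _; apply: leq_trans (card_bigcup_leq _ _) _.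
rewrite mulnC -sum_nat_const; apply: leq_sum => s /KD; rewrite in_set => /eqP cs.
by rewrite cards_draws cs binSn.
Qed.

End Heavy.

(** * Numbers of cores of a given size *)

(** Starting from [e ^ 2], the final potential and the initial simplex use up at most half of the
    exponent once [m] is at least 4. *)
Lemma card_sparse_cores_sqr n d (H : {set {set 'I_n}}) e m : 1 < d -> 0 < e -> 3 < m ->
  #|[set K | sparse_core d H (e ^ 2) K && (#|K| == m)]| * e ^ m <= 2 ^ m * n ^ (d + m).
Proof.
move=> d2 e0; case: m => // m m4.
have := @card_sparse_cores n d H (e ^ 2) m d2; rewrite expn_gt0 e0 => /(_ isT).
set N := #|_| => le1; rewrite -!expnM in le1.
have g0 : 0 < e ^ (2 * (m.+1 %/ 4)) by rewrite expn_gt0 e0.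
rewrite -(leq_pmul2r g0) -mulnA -expnD.
apply: (@leq_trans (N * e ^ (2 * m))).
  rewrite leq_mul2l leq_pexp2l ?orbT //.
  by move: m4 {le1 g0 N}; clear; lia.
apply: leq_trans le1 _; rewrite mulnA leq_mul2r expnMn mulnCA -expnD addSnnS.
by rewrite leq_mul2r [2 ^ m.+1]expnS leq_pmull ?orbT.
Qed.

Lemma card_cover_core n d (K : {set {set 'I_n}}) : is_core d K ->
  #|cover K| <= d.+1 * #|K|.
Proof.
move=> cK; apply: leq_trans (leq_card_cover K).1 _.
rewrite mulnC -sum_nat_const; apply: leq_sum => s sK.
by rewrite (core_simplex cK sK).
Qed.

Lemma card_small_cores n d e m : 1 < d -> 0 < e -> 3 < m ->
  d.+1 * m * (e ^ 2) ^ d.+2 <= n ->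
  #|[set K : {set {set 'I_n}} | is_minimal_core d K && (#|K| == m)]| * e ^ m
    <= 2 ^ m * n ^ (d + m).
Proof.
move=> d2 e0 m4 mn; apply: leq_trans (card_sparse_cores_sqr set0 d2 e0 m4).
rewrite leq_mul2r; apply/orP; right; apply/subset_leq_card/subsetP => K.
rewrite !in_set => /andP[mK /eqP cK]; rewrite /sparse_core mK cK eqxx andbT /=.
have core : is_core d K by case/andP: mK.
apply/andP; split.
  suff -> : pinned_faces d set0 K = set0 by rewrite cards0.
  apply/setP => f; rewrite in_set0; apply/negbTE/negP.
  rewrite in_set => /andP[/facesP[cf _] /forallP pf].
  have /set0Pn[x xf] : f != set0 by rewrite -card_gt0 cf ltnW.
  by have := pf x; rewrite xf => /existsP[w]; rewrite in_set0.
apply/forallP => f; apply/implyP => fF; apply: leq_trans mn.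
rewrite leq_mul2r; apply/orP; right; rewrite -cK.
apply: leq_trans (card_cover_core core).
apply/subset_leq_card/subsetP => v; rewrite in_set => /existsP[w /and3P[_ _]].
rewrite in_set0 /= => /facesP[_ [s sK vs]]; apply/bigcupP; exists s => //.
by apply: (subsetP vs); rewrite setU11.
Qed.

Lemma card_bounded_subsets (T : finType) (U : {set T}) q :
  #|[set A : {set T} | (A \subset U) && (#|A| <= q)]| <= #|U|.+1 ^ q.
Proof.
elim: q => [|q IH].
  rewrite expn0 -(cards1 (@set0 T)); apply/subset_leq_card/subsetP => A.
  by rewrite in_set leqn0 cards_eq0 => /andP[_ /eqP->]; rewrite set11.
set P := [set _ | _] in IH; set P' := [set _ | _].
have sub : P' \subset P :|: \bigcup_(x in U) [set x |: A | A in P].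
  apply/subsetP => A; rewrite in_set => /andP[AU Aq].
  have [A0|[x xA]] := set_0Vmem A.
    by rewrite in_setU in_set A0 sub0set cards0.
  rewrite in_setU; apply/orP; right; apply/bigcupP; exists x; first exact: (subsetP AU).
  apply/imsetP; exists (A :\ x); last by rewrite setD1K.
  rewrite in_set (subset_trans (subD1set _ _) AU) /=.
  by rewrite (cardsD1 x) xA in Aq.
apply: leq_trans (subset_leq_card sub) _; apply: leq_trans (leq_card_setU _ _) _.
rewrite expnS mulSn leq_add //; apply: leq_trans (card_bigcup_leq _ _) _.
rewrite -sum_nat_const; apply: leq_sum => x _.
by apply: leq_trans (leq_imset_card _ _) _.
Qed.

Lemma card_small_sets n d : 0 < n -> #|[set w : {set 'I_n} | #|w| < d]| <= d * n ^ d.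
Proof.
move=> n0; have sub : [set w : {set 'I_n} | #|w| < d] \subset
    \bigcup_(k < d) [set w : {set 'I_n} | #|w| == k].
  apply/subsetP => w; rewrite in_set => wd; apply/bigcupP.
  by exists (Ordinal wd) => //; rewrite in_set.
apply: leq_trans (subset_leq_card sub) _; apply: leq_trans (card_bigcup_leq _ _) _.
rewrite -[X in _ <= X * _]card_ord -sum_nat_const; apply: leq_sum => k _.
rewrite card_draws card_ord; apply: leq_trans (bin_leq_expn _ _) _.
by rewrite leq_pexp2l // ltnW.
Qed.

Lemma card_large_cores n d a e m b : 1 < d -> 0 < n -> 0 < e -> 3 < m ->
  4 * (d * (2 ^ d * d * (2 ^ d * d.+1))) <= a ->
  2 ^ d * d * (e ^ 2) ^ d.+2 <= a ->
  threshold d a 0 * (d.+1 * m) < n ^ d ->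
  d * n ^ d < 2 ^ b -> b * (d * (threshold d a 0 * (2 ^ d * d.+1))) <= n ->
  #|[set K : {set {set 'I_n}} | is_minimal_core d K && (#|K| == m)]| * e ^ m
    <= 4 ^ m * n ^ (d + m).
Proof.
move=> d2 n0 e0 m4 a1 a2 mn nb bn.
have d0 : 0 < d by apply: ltnW.
have E0 : 0 < (e ^ 2) ^ d.+2 by rewrite !expn_gt0 e0.
have a0 : 0 < a by apply: leq_trans a2; rewrite muln_gt0 E0 muln_gt0 d0 expn_gt0.
set Q := d * _ in bn; pose q := (Q * m) %/ n.
pose U := [set w : {set 'I_n} | #|w| < d].
set X := [set K | _].
have sub : X \subset \bigcup_(H in [set A : {set {set 'I_n}} | (A \subset U) && (#|A| <= q)])
    [set K | sparse_core d H (e ^ 2) K && (#|K| == m)].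
  apply/subsetP => K; rewrite in_set => /andP[mK /eqP cK].
  have core : is_core d K by case/andP: mK.
  have cF : #|faces d K| <= d.+1 * m.
    by rewrite -cK; apply: card_faces; case/andP: core => /andP[].
  have H0 : set0 \notin heavy d a K.
    by apply: set0_light; apply: leq_ltn_trans mn; rewrite leq_mul2l cF orbT.
  apply/bigcupP; exists (heavy d a K).
    rewrite in_set; apply/andP; split.
      by apply/subsetP => w; rewrite !in_set => /andP[].
    rewrite leq_divRL //; apply: leq_trans (card_heavy d K n0 a0) _.
    by rewrite /Q -!mulnA !leq_mul2l cF !orbT.
  rewrite in_set cK eqxx andbT /sparse_core mK /=; apply/andP; split.
    rewrite -(leq_pmul2r a0) -mulnA.
    apply: leq_trans (leq_mul (leqnn 4) (card_pinned n0 a0 d0 H0)) _.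
    apply: (@leq_trans (m * (4 * (d * (2 ^ d * d * (2 ^ d * d.+1)))))).
      apply: (@leq_trans (4 * (d * (2 ^ d * d * (2 ^ d * (d.+1 * m)))))).
        2: by apply/eq_leq; ring.
      by rewrite !leq_mul2l cF !orbT.
    by rewrite cK leq_mul2l a1 orbT.
  apply/forallP => f; apply/implyP => fF; rewrite -(leq_pmul2r a0).
  rewrite mulnAC; apply: leq_trans (leq_mul (card_saving_heavy n0 a0 fF) (leqnn _)) _.
  apply: (@leq_trans (n * (2 ^ d * d * (e ^ 2) ^ d.+2))); last by rewrite leq_mul2l a2 orbT.
  by apply/eq_leq; ring.
apply: leq_trans (leq_mul (subset_leq_card sub) (leqnn _)) _.
apply: leq_trans (leq_mul (card_bigcup_leq _ _) (leqnn _)) _.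
rewrite big_distrl /=.
apply: (@leq_trans (\sum_(H in [set A : {set {set 'I_n}} | (A \subset U) && (#|A| <= q)])
   2 ^ m * n ^ (d + m))).
  by apply: leq_sum => H _; apply: card_sparse_cores_sqr.
rewrite sum_nat_const mulnA leq_mul2r; apply/orP; right.
rewrite (_ : 4 = 2 * 2) // expnMn leq_mul2r; apply/orP; right.
apply: leq_trans (card_bounded_subsets _ _) _.
apply: (@leq_trans ((2 ^ b) ^ q)).
  case: (q) => // q'; rewrite leq_exp2r //.
  by apply: leq_ltn_trans nb; apply: card_small_sets.
rewrite -expnM leq_pexp2l // -(leq_pmul2r n0) -mulnA.
apply: (@leq_trans (b * (Q * m))); first by rewrite leq_mul2l leq_trunc_div orbT.
by rewrite mulnA mulnC leq_mul2l bn orbT.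
Qed.

Lemma card_tiny_cores n d m : 1 < d -> 0 < n ->
  #|[set K : {set {set 'I_n}} |
      [&& is_core d K, ~~ contains_boundary d K & #|K| == m.+1]]|
    <= m.+1 * (n ^ m * 2 ^ (2 ^ m)).
Proof.
move=> d2 n0; set X := [set K | _].
have sub : X \subset \bigcup_(j < m.+1) \bigcup_(V in [set V : {set 'I_n} | #|V| == j])
    powerset (powerset V).
  apply/subsetP => K; rewrite in_set => /and3P[cK nb /eqP Km].
  have := core_few_vertices cK d2 nb; rewrite Km => cV.
  apply/bigcupP; exists (Ordinal cV) => //; apply/bigcupP; exists (cover K).
    by rewrite in_set.
  rewrite powersetE; apply/subsetP => s sK; rewrite powersetE.
  exact: bigcup_sup.
apply: leq_trans (subset_leq_card sub) _; apply: leq_trans (card_bigcup_leq _ _) _.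
rewrite -[X in _ <= X * _]card_ord -sum_nat_const; apply: leq_sum => j _.
apply: leq_trans (card_bigcup_leq _ _) _.
have jm : j <= m by rewrite -ltnS.
apply: (@leq_trans (\sum_(V in [set V : {set 'I_n} | #|V| == j]) 2 ^ (2 ^ m))).
  apply: leq_sum => V; rewrite in_set => /eqP Vj.
  by rewrite !card_powerset Vj !leq_pexp2l.
rewrite sum_nat_const leq_mul2r card_draws card_ord; apply/orP; right.
by apply: leq_trans (bin_leq_expn _ _) _; rewrite leq_pexp2l.
Qed.

(** * First moment bound *)

Import Order.TTheory GRing.Theory Num.Theory.
Local Open Scope ring_scope.

Lemma sum_subset_weights (R : comNzRingType) (T : finType) (D : {set T}) (p : R) :
  \sum_(Y : {set T} | Y \subset D) p ^+ #|Y| * (1 - p) ^+ (#|D| - #|Y|) = 1.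
Proof.
transitivity ((1 - p + p) ^+ #|D|); last by rewrite subrK expr1n.
rewrite exprDn.
rewrite (partition_big (fun Y : {set T} => inord #|Y| : 'I_(#|D|).+1) predT) //=.
apply: eq_bigr => i _.
have szE (Y : {set T}) : Y \subset D -> (inord #|Y| == i :> 'I_(#|D|).+1) = (#|Y| == i).
  by move=> YD; rewrite -val_eqE /= inordK // ltnS subset_leq_card.
rewrite (eq_bigr (fun=> (1 - p) ^+ (#|D| - i) * p ^+ i)); last first.
  by move=> Y /andP[YD]; rewrite szE // => /eqP ->; rewrite mulrC.
rewrite sumr_const; congr (_ *+ _); rewrite -cards_draws.
apply: eq_card => Y; rewrite !inE unfold_in.
by case YD: (Y \subset D) => //=; rewrite szE.
Qed.

Lemma sum_superset_weights (R : comNzRingType) (T : finType) (D K : {set T}) (p : R) :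
  K \subset D ->
  \sum_(Y : {set T} | (Y \subset D) && (K \subset Y)) p ^+ #|Y| * (1 - p) ^+ (#|D| - #|Y|)
    = p ^+ #|K|.
Proof.
move=> KD; transitivity (p ^+ #|K| *
    \sum_(Z : {set T} | Z \subset D :\: K) p ^+ #|Z| * (1 - p) ^+ (#|D :\: K| - #|Z|)).
  2: by rewrite sum_subset_weights mulr1.
rewrite big_distrr /=.
rewrite (reindex_onto (fun Z => K :|: Z) (fun Y => Y :\: K)) /=; last first.
  by move=> Y /andP[_ KY]; rewrite -{1}(setIidPr KY) setID.
apply: eq_big => Z.
  rewrite subUset KD subsetUl andbT subsetD setDUl setDv set0U /=.
  congr (_ && _); apply/eqP/idP => [/setDidPl//|ZK]; exact/setDidPl.
case/andP=> _ /eqP ZE; have dZ : [disjoint K & Z].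
  by rewrite disjoint_sym; apply/setDidPl; rewrite -{2}ZE setDUl setDv set0U.
rewrite cardsU disjoint_setI0 // cards0 subn0 cardsD (setIidPr KD) subnDA.
by rewrite exprD -mulrA.
Qed.

Definition bad_cores (R : realType) (n d : nat) (delta : R) (m : nat) :
    {set {set {set 'I_n}}} :=
  [set K : {set {set 'I_n}} | [&& is_minimal_core d K, #|K|%:R <= delta * n%:R ^+ d,
     ~~ contains_boundary d K & #|K| == m]].

Lemma prob_good_ge (R : realType) (n d : nat) (p delta : R) : 0 <= p <= 1 ->
  1 - \sum_(m < #|dsimplices n d|.+1) #|@bad_cores R n d delta m|%:R * p ^+ m
    <= @prob_Yd R n d p (@good_event R n d delta).
Proof.
move=> /andP[p0 p1]; set D := dsimplices n d.
pose wt (Y : {set {set 'I_n}}) := p ^+ #|Y| * (1 - p) ^+ (#|D| - #|Y|).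
have wt0 Y : 0 <= wt Y by rewrite mulr_ge0 // exprn_ge0 // subr_ge0.
pose bad (K : {set {set 'I_n}}) := [&& is_minimal_core d K, #|K|%:R <= delta * n%:R ^+ d &
     ~~ contains_boundary d K].
have badD K : bad K -> K \subset D by case/andP=> /andP[/andP[/andP[]]].
have wt1 : \sum_(Y : {set {set 'I_n}} | Y \subset D) wt Y = 1 by rewrite sum_subset_weights.
rewrite -[X in X - _]wt1 (bigID (@good_event R n d delta)) /= lerBlDr /prob_Yd lerD2l.
apply: (@le_trans _ _ (\sum_(Y : {set {set 'I_n}} | Y \subset D)
    \sum_(K : {set {set 'I_n}} | bad K && (K \subset Y)) wt Y)).
  rewrite [X in _ <= X](bigID (@good_event R n d delta)) /=.
  apply: (@le_trans _ _ (\sum_(Y : {set {set 'I_n}} | (Y \subset D) && ~~ good_event d delta Y)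
     \sum_(K : {set {set 'I_n}} | bad K && (K \subset Y)) wt Y)); last first.
    by rewrite lerDr sumr_ge0 // => Y _; apply: sumr_ge0.
  apply: ler_sum => Y /andP[_]; rewrite negb_forall => /existsP[K].
  rewrite negb_imply => /andP[/andP[/andP[KY mK] Kd] nb].
  have bK : bad K && (K \subset Y) by rewrite /bad mK Kd nb KY.
  by rewrite (bigD1 K) //= lerDl sumr_ge0.
rewrite (exchange_big_dep bad) /=; last by move=> Y K _ /andP[].
rewrite (eq_bigr (fun K : {set {set 'I_n}} => p ^+ #|K|)); last first.
  move=> K bK; rewrite -(sum_superset_weights p (badD K bK)).
  by apply: eq_bigl => Y; rewrite bK.
rewrite (partition_big (fun K : {set {set 'I_n}} => inord #|K| : 'I_(#|D|).+1) predT) //=.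
apply: ler_sum => m _.
rewrite (eq_bigr (fun=> p ^+ m)); last first.
  move=> K /andP[bK]; rewrite -val_eqE /= inordK ?ltnS ?subset_leq_card ?badD //.
  by move/eqP ->.
rewrite sumr_const -[_ ^+ m *+ _]mulr_natl ler_wpM2r ?exprn_ge0 // ler_nat.
apply/subset_leq_card/subsetP => K; rewrite unfold_in => /andP[bK].
rewrite -val_eqE /= inordK ?ltnS ?subset_leq_card ?badD // => Km.
by case/and3P: bK => b1 b2 b3; rewrite in_set b1 b2 b3 Km.
Qed.

Lemma expn_leq_pow2 (k e : nat) : (0 < k)%N -> (e ^ k <= k ^ k * 2 ^ e)%N.
Proof.
move=> k0; apply: (@leq_trans ((k * 2 ^ (e %/ k)) ^ k)%N).
  rewrite leq_exp2r // (leq_trans (ltnW (ltn_ceil e k0))) // mulnC leq_mul2l.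
  by rewrite ltn_expl ?orbT.
by rewrite expnMn leq_mul2l -expnM leq_pexp2l ?orbT // leq_trunc_div.
Qed.

Lemma root_floor (E n : nat) : (0 < E)%N -> exists e, (e ^ E <= n < e.+1 ^ E)%N.
Proof.
move=> E0; have ex : exists e, (e ^ E <= n)%N by exists 0%N; rewrite exp0n.
have bnd e : (e ^ E <= n)%N -> (e <= n)%N.
  by apply: leq_trans; case: e => // e; rewrite -{1}[e.+1]expn1 leq_pexp2l.
case: (ex_maxnP ex bnd) => e le1 emax; exists e; rewrite le1 ltnNge /=.
by apply/negP => /emax; rewrite ltnn.
Qed.

Lemma poly_lt_pow2 (d Q : nat) : (0 < Q)%N ->
  exists N, forall n, (N <= n)%N -> (d * n ^ d < 2 ^ (n %/ Q))%N.
Proof.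
move=> Q0; pose C := (d * Q ^ d * (d.+1 ^ d.+1 * 2))%N.
exists (Q * C)%N => n; rewrite mulnC -leq_divRL //; set b := (n %/ Q)%N => Cb.
rewrite -(@ltn_pmul2r b.+1) //.
have nQ : (n ^ d <= (Q * b.+1) ^ d)%N.
  case: (d) => // d'; rewrite leq_exp2r // mulnC ltnW //; exact: ltn_ceil.
apply: (@leq_ltn_trans (d * Q ^ d * (b.+1) ^ d.+1)).
  by rewrite expnSr mulnA leq_mul2r -mulnA -expnMn leq_mul2l nQ !orbT.
apply: (@leq_ltn_trans (C * 2 ^ b)); last by rewrite mulnC ltn_mul2l expn_gt0.
apply: leq_trans (leq_mul (leqnn _) (expn_leq_pow2 b.+1 (ltn0Sn d))) _.
by rewrite /C [(2 ^ b.+1)%N]expnS !mulnA.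
Qed.

Lemma sum_half_powers (R : realFieldType) (M : nat) : \sum_(m < M) (2^-1 : R) ^+ m <= 2.
Proof.
suff -> : \sum_(m < M) (2^-1 : R) ^+ m = 2 - 2 * 2^-1 ^+ M.
  by rewrite gerBl mulr_ge0 // exprn_ge0 // invr_ge0.
elim: M => [|M IH]; first by rewrite big_ord0 expr0; ring.
by rewrite big_ord_recr /= IH exprS; field.
Qed.

Lemma bad_cores_sub (R : realType) (n d m : nat) (delta : R) :
  @bad_cores R n d delta m \subset
  [set K : {set {set 'I_n}} | is_minimal_core d K && (#|K| == m)].
Proof. by apply/subsetP => K; rewrite !in_set => /and4P[-> _ _ ->]. Qed.

Lemma expected_count_le (R : realType) (n d m N u v : nat) (c : R) :
  0 <= c -> (0 < n)%N -> (0 < u)%N -> (N * u ^ m <= v ^ m * n ^ (d + m))%N ->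
  N%:R * (c / n%:R) ^+ m <= n%:R ^+ d * (v%:R * c / u%:R) ^+ m.
Proof.
move=> c0 n0 u0; rewrite -(ler_nat R) !natrM !natrX => le1.
have nR : 0 < n%:R :> R by rewrite ltr0n.
have uR : 0 < u%:R :> R by rewrite ltr0n.
have um : 0 < (u%:R : R) ^+ m by rewrite exprn_gt0.
have nm : 0 < (n%:R : R) ^+ m by rewrite exprn_gt0.
rewrite !expr_div_n exprMn.
have -> : N%:R * (c ^+ m / n%:R ^+ m) =
    N%:R * u%:R ^+ m * (c ^+ m / n%:R ^+ m / u%:R ^+ m) :> R.
  by field; rewrite !gt_eqF.
have -> : n%:R ^+ d * (v%:R ^+ m * c ^+ m / u%:R ^+ m) =
    v%:R ^+ m * n%:R ^+ (d + m) * (c ^+ m / n%:R ^+ m / u%:R ^+ m) :> R.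
  by rewrite exprD; field; rewrite !gt_eqF.
by rewrite ler_wpM2r // !divr_ge0 ?exprn_ge0 ?ler0n.
Qed.

Lemma tiny_term_le (R : realType) (n d m : nat) (c delta : R) :
  0 <= c -> (1 < d)%N -> (0 < n)%N ->
  #|@bad_cores R n d delta m|%:R * (c / n%:R) ^+ m <= (m * 2 ^ (2 ^ m))%:R * c ^+ m / n%:R.
Proof.
move=> c0 d2 n0; case: m => [|m].
  suff -> : @bad_cores R n d delta 0 = set0.
    by rewrite cards0 !mul0r.
  apply/setP => K; rewrite in_set0; apply/negbTE/negP; rewrite in_set.
  case/and4P=> /andP[/andP[/andP[_ K0] _] _] _ _ /eqP cK.
  by rewrite -card_gt0 cK in K0.
have nR : 0 < n%:R :> R by rewrite ltr0n.
have sub : (#|@bad_cores R n d delta m.+1| <= m.+1 * (n ^ m * 2 ^ (2 ^ m.+1)))%N.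
  apply: (@leq_trans (m.+1 * (n ^ m * 2 ^ (2 ^ m)))%N); last first.
    by rewrite !leq_mul2l !leq_pexp2l ?orbT.
  apply: leq_trans (card_tiny_cores m d2 n0).
  apply/subset_leq_card/subsetP => K; rewrite !in_set => /and4P[/andP[-> _] _ -> ->].
  by [].
rewrite -(ler_nat R) !natrM in sub.
rewrite expr_div_n; apply: le_trans (ler_wpM2r _ sub) _.
  by rewrite divr_ge0 ?exprn_ge0 // ler0n.
rewrite le_eqVlt; apply/orP/or_introl/eqP; rewrite natrM !natrX [n%:R ^+ m.+1]exprS.
by field; rewrite !gt_eqF ?exprn_gt0.
Qed.

Lemma large_delta (R : realType) (n d m T : nat) : (0 < T)%N -> (0 < m)%N ->
  m%:R <= (T * d.+2)%:R^-1 * n%:R ^+ d :> R -> (T * (d.+1 * m) < n ^ d)%N.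
Proof.
move=> T0 m0; rewrite ler_pdivlMl ?ltr0n ?muln_gt0 ?T0 // -natrX -natrM ler_nat.
by apply: leq_trans; rewrite -mulnA ltn_pmul2l // ltn_pmul2r.
Qed.

Lemma term_le (R : realType) (n d a e e0 b m M : nat) (c delta : R) :
  let T := threshold d a 0 in
  0 <= c -> (1 < d)%N -> (0 < n)%N -> (3 < M)%N -> (M <= m)%N ->
  (4 * (d * (2 ^ d * d * (2 ^ d * d.+1))) <= a)%N ->
  (2 ^ d * d * (e0 ^ 2) ^ d.+2 <= a)%N ->
  (d * n ^ d < 2 ^ b)%N -> (b * (d * (T * (2 ^ d * d.+1))) <= n)%N ->
  (d.+1 <= e)%N -> (e ^ (2 * d + 6) <= n)%N ->
  4 * c <= e%:R -> (0 < e0)%N -> 16 * c <= e0%:R ->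
  delta = (T * d.+2)%:R^-1 ->
  #|@bad_cores R n d delta m|%:R * (c / n%:R) ^+ m
   <= n%:R ^+ d * ((4 * c / e%:R) ^+ M + 2^-1 ^+ e) * 2^-1 ^+ m.
Proof.
move=> T c0 d2 n0 M4 Mm a1 a2 nb bn de en ce e00 ce0 deltaE.
have e1 : (0 < e)%N by apply: leq_trans de.
have m4 : (3 < m)%N by apply: leq_trans Mm.
have a0 : (0 < a)%N.
  by apply: leq_trans a1; rewrite !muln_gt0 !expn_gt0 /= (ltnW d2).
have T0 : (0 < T)%N by apply: threshold_gt0.
have eR : 0 < e%:R :> R by rewrite ltr0n.
have e0R : 0 < e0%:R :> R by rewrite ltr0n.
have nd0 : 0 <= n%:R ^+ d :> R by rewrite exprn_ge0 ?ler0n.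
have h0 k : 0 <= (2^-1 : R) ^+ k by rewrite exprn_ge0 // invr_ge0.
have x0 : 0 <= 4 * c / e%:R by rewrite divr_ge0 ?mulr_ge0 ?ler0n.
have N_le : (#|@bad_cores R n d delta m| <=
    #|[set K : {set {set 'I_n}} | is_minimal_core d K && (#|K| == m)]|)%N.
  exact: subset_leq_card (bad_cores_sub _ _ _ _).
have [me|em] := leqP m e.
  have cond : (d.+1 * m * (e ^ 2) ^ d.+2 <= n)%N.
    apply: leq_trans en.
    apply: (@leq_trans (e * e * (e ^ 2) ^ d.+2)%N).
      by rewrite leq_mul2r leq_mul ?orbT.
    by rewrite mulnn -expnM -expnD leq_pexp2l // mulnS; lia.
  have := card_small_cores d2 e1 m4 cond.
  move/(leq_trans (leq_mul N_le (leqnn _)))/(expected_count_le c0 n0 e1) => le1.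
  apply: le_trans le1 _; rewrite -[X in _ <= X]mulrA ler_wpM2l //.
  have -> : 2%:R * c / e%:R = (4 * c / e%:R) * 2^-1 by field; rewrite gt_eqF.
  rewrite exprMn ler_wpM2r //; apply: (@le_trans _ _ ((4 * c / e%:R) ^+ M)).
    by rewrite ler_wiXn2l // ler_pdivrMr // mul1r.
  by rewrite lerDl.
have [B0|[K]] := set_0Vmem (@bad_cores R n d delta m).
  by rewrite B0 cards0 mul0r !mulr_ge0 // addr_ge0 // exprn_ge0.
rewrite in_set => /and4P[_ Kd _ /eqP Km].
rewrite Km deltaE in Kd.
have mT : (T * (d.+1 * m) < n ^ d)%N by apply: large_delta Kd => //; apply: ltn_trans m4.
have := card_large_cores d2 n0 e00 m4 a1 a2 mT nb bn.
move/(leq_trans (leq_mul N_le (leqnn _)))/(expected_count_le c0 n0 e00) => le1.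
apply: le_trans le1 _; rewrite -[X in _ <= X]mulrA ler_wpM2l //.
apply: (@le_trans _ _ ((2^-1 * 2^-1) ^+ m)).
  apply: lerXn2r; rewrite ?nnegrE ?divr_ge0 ?mulr_ge0 ?invr_ge0 ?ler0n //.
  by rewrite ler_pdivrMr //; lra.
rewrite exprMn ler_wpM2r //; apply: (@le_trans _ _ (2^-1 ^+ e)).
  by rewrite ler_wiXn2l ?invr_ge0 ?invf_le1 ?ler1n // ltnW.
by rewrite lerDr exprn_ge0.
Qed.

Lemma error_le (R : realType) (n d e k : nat) (x : R) :
  0 <= x -> (0 < e)%N -> (n < e.+1 ^ k)%N ->
  n%:R ^+ d * ((x / e%:R) ^+ (k * d).+2 + 2^-1 ^+ e) <=
  (2 ^+ (k * d) * (x ^+ (k * d).+2 + ((k * d).+1 ^ (k * d).+1)%:R)) / e%:R.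
Proof.
move=> x0 e0 ne; have eR : 0 < e%:R :> R by rewrite ltr0n.
have e1 : 1 <= e%:R :> R by rewrite ler1n.
set r := (k * d)%N.
have nd : n%:R ^+ d <= 2 ^+ r * e%:R ^+ r :> R.
  rewrite -exprMn /r exprM lerXn2r ?nnegrE ?exprn_ge0 ?mulr_ge0 ?ler0n //.
  apply: (@le_trans _ _ ((e.+1 ^ k)%N%:R)); first by rewrite ler_nat ltnW.
  rewrite natrX lerXn2r ?nnegrE ?mulr_ge0 ?ler0n // -natrM ler_nat.
  by rewrite mul2n -addnn -addn1 leq_add2l.
have h0 : 0 <= (2^-1 : R) ^+ e by rewrite exprn_ge0 // invr_ge0.
apply: le_trans (ler_wpM2r _ nd) _.
  by rewrite addr_ge0 // exprn_ge0 // divr_ge0 ?ler0n.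
rewrite -!mulrA ler_wpM2l ?exprn_ge0 // mulrDr mulrDl lerD //.
  rewrite expr_div_n mulrCA ler_wpM2l ?exprn_ge0 //.
  rewrite !exprSr !invfM -!mulrA.
  rewrite mulVKf ?expf_neq0 ?gt_eqF // ler_piMl ?invr_ge0 ?ler0n //.
  by rewrite invf_le1.
rewrite ler_pdivlMr // mulrAC -exprSr exprVn ler_pdivrMr ?exprn_gt0 //.
by rewrite -!natrX -natrM ler_nat expn_leq_pow2.
Qed.

Theorem theorem7 (R : realType) (d : nat) (hd : (2 <= d)%N) (c : R) (hc : 0 < c) :
  exists delta : R, 0 < delta /\
    forall eps : R, 0 < eps ->
      exists N0 : nat, forall n : nat, (N0 <= n)%N ->
        1 - eps <= @prob_Yd R n d (c / n%:R) (@good_event R n d delta).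
Proof.
have c0 := ltW hc; have d0 : (0 < d)%N by apply: ltnW.
pose e0 := Num.bound (16 * c); pose e1 := Num.bound (4 * c); pose n1 := Num.bound c.
have he0 : 16 * c < e0%:R by apply: archi_boundP; rewrite mulr_ge0.
have he1 : 4 * c < e1%:R by apply: archi_boundP; rewrite mulr_ge0.
have hn1 : c < n1%:R by apply: archi_boundP.
have e00 : (0 < e0)%N by rewrite -(ltr0n R); apply: le_lt_trans he0; rewrite mulr_ge0.
pose a := (4 * (d * (2 ^ d * d * (2 ^ d * d.+1))) + 2 ^ d * d * (e0 ^ 2) ^ d.+2)%N.
have a1 : (4 * (d * (2 ^ d * d * (2 ^ d * d.+1))) <= a)%N by apply: leq_addr.
have a2 : (2 ^ d * d * (e0 ^ 2) ^ d.+2 <= a)%N by apply: leq_addl.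
have a0 : (0 < a)%N by apply: leq_trans a1; rewrite !muln_gt0 !expn_gt0 /= d0.
pose T := threshold d a 0; have T0 : (0 < T)%N by apply: threshold_gt0.
pose Q := (d * (T * (2 ^ d * d.+1)))%N.
have Q0 : (0 < Q)%N by rewrite !muln_gt0 expn_gt0 d0 T0.
have [N1 hN1] := poly_lt_pow2 d Q0.
pose E := (2 * d + 6)%N; pose M := (E * d).+2.
have E0 : (0 < E)%N by rewrite /E addnS.
have M4 : (3 < M)%N by rewrite /M !ltnS (leq_trans _ (leq_pmulr E d0)) // /E addnC.
exists (T * d.+2)%:R^-1; split; first by rewrite invr_gt0 ltr0n muln_gt0 T0.
move=> eps eps0; set delta : R := (_)^-1.
pose C1 : R := \sum_(m < M) (m * 2 ^ (2 ^ m))%:R * c ^+ m.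
pose C2 : R := 2 ^+ (E * d) * ((4 * c) ^+ M + ((E * d).+1 ^ (E * d).+1)%:R).
have C1_0 : 0 <= C1 by apply: sumr_ge0 => m _; rewrite mulr_ge0 ?ler0n // exprn_ge0.
have C2_0 : 0 <= C2.
  apply: mulr_ge0; first exact: exprn_ge0.
  by rewrite addr_ge0 ?ler0n // exprn_ge0 // mulr_ge0.
have C_0 : 0 <= C1 + C2 * 2 by rewrite addr_ge0 // (mulr_ge0 C2_0).
pose e2 := Num.bound ((C1 + C2 * 2) / eps).
have he2 : (C1 + C2 * 2) / eps < e2%:R.
  by apply: archi_boundP; rewrite divr_ge0 // ltW.
pose s := maxn e1 (maxn e2 (maxn d.+1 n1)).
exists (N1 + s ^ E)%N => n hn.
have [e /andP[en ne]] := root_floor n E0.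
have se : (s <= e)%N.
  rewrite -ltnS -(ltn_exp2r s e.+1 E0); apply: leq_ltn_trans ne.
  exact: leq_trans (leq_addl _ _) hn.
have [e1e e2e de n1e] : [/\ (e1 <= e)%N, (e2 <= e)%N, (d.+1 <= e)%N & (n1 <= e)%N].
  by move: se; rewrite !geq_max => /and4P[].
have ep : (0 < e)%N by apply: leq_trans de.
have len : (e <= n)%N.
  by apply: leq_trans en; rewrite -{1}[e]expn1 leq_pexp2l.
have n0 : (0 < n)%N by apply: leq_trans len.
have eR : 0 < e%:R :> R by rewrite ltr0n.
have nR : 0 < n%:R :> R by rewrite ltr0n.
have nb : (d * n ^ d < 2 ^ (n %/ Q))%N by apply: hN1; apply: leq_trans hn; apply: leq_addr.
have bn : (n %/ Q * Q <= n)%N by apply: leq_trunc_div.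
have p01 : 0 <= c / n%:R <= 1.
  rewrite divr_ge0 ?ler0n // ler_pdivrMr // mul1r ltW //=.
  by apply: lt_le_trans hn1 _; rewrite ler_nat (leq_trans n1e).
have ce : 4 * c <= e%:R by apply: le_trans (ltW he1) _; rewrite ler_nat.
apply: le_trans (prob_good_ge n d delta p01); rewrite lerD2l lerN2.
pose B : R := n%:R ^+ d * ((4 * c / e%:R) ^+ M + 2^-1 ^+ e).
have B0 : 0 <= B.
  rewrite mulr_ge0 ?exprn_ge0 ?ler0n // addr_ge0 ?exprn_ge0 ?invr_ge0 //.
  by rewrite divr_ge0 ?mulr_ge0 ?ler0n.
pose t m := #|@bad_cores R n d delta m|%:R * (c / n%:R) ^+ m.
pose t1 m : R := if (m < M)%N then (m * 2 ^ (2 ^ m))%:R * c ^+ m / n%:R else 0.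
have t1_0 m : 0 <= t1 m.
  by rewrite /t1; case: ifP => // _; rewrite divr_ge0 ?mulr_ge0 ?exprn_ge0 ?ler0n.
have tle m : t m <= t1 m + B * 2^-1 ^+ m.
  have [mM|Mm] := ltnP m M.
    apply: (@le_trans _ _ (t1 m)); last by rewrite lerDl mulr_ge0 // exprn_ge0 // invr_ge0.
    by rewrite /t1 mM; apply: tiny_term_le.
  apply: (@le_trans _ _ (B * 2^-1 ^+ m)); last by rewrite lerDr.
  exact: (term_le (a := a) (e0 := e0) (b := n %/ Q)) (ltW he0) _.
set L := #|dsimplices n d|.+1.
apply: (@le_trans _ _ (\sum_(m < L) (t1 m + B * 2^-1 ^+ m))).
  by apply: ler_sum => m _; apply: tle.
rewrite big_split /= -mulr_sumr.
have S1 : \sum_(m < L) t1 m <= C1 / e%:R.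
  apply: (@le_trans _ _ (C1 / n%:R)); last first.
    by rewrite ler_wpM2l // lef_pV2 ?posrE // ler_nat.
  have -> : C1 / n%:R = \sum_(m < M) t1 m.
    by rewrite mulr_suml; apply: eq_bigr => m _; rewrite /t1 ltn_ord.
  rewrite -!(big_mkord xpredT t1); have [LM|ML] := leqP L M.
    by rewrite (@big_cat_nat _ _ _ L 0 M) //= lerDl sumr_ge0.
  rewrite (@big_cat_nat _ _ _ M 0 L) ?(ltnW ML) //=.
  rewrite gerDl big_nat_cond big1 // => m /andP[/andP[Mm _] _].
  by rewrite /t1 ltnNge Mm.
have S2 : B * \sum_(m < L) 2^-1 ^+ m <= C2 / e%:R * 2.
  apply: (@le_trans _ _ (B * 2)); first by rewrite ler_wpM2l // sum_half_powers.
  by rewrite ler_wpM2r // error_le // mulr_ge0.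
apply: le_trans (lerD S1 S2) _.
have -> : C1 / e%:R + C2 / e%:R * 2 = (C1 + C2 * 2) / e%:R by field; rewrite gt_eqF.
rewrite ler_pdivrMr // -ler_pdivrMl // mulrC; apply: le_trans (ltW he2) _.
by rewrite ler_nat.
Qed.
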